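(* Let $W\subseteq V$ be an inner model of ZFC, $\kappa$ a regular uncountable cardinal in $V$, and $\lambda>\kappa$ a cardinal of $W$. Let $\mathcal P\in W$ with $W\models$ ''$\mathcal P\subseteq[\lambda]^{<\kappa}$ and $|\mathcal P|=\lambda$''. Then $(\mathrm{F})_{\mathcal P,\kappa}$ implies $(\mathrm{G})_{\mathcal P,\kappa}$.
   Context: $(\mathrm{F})_{\mathcal P,\kappa}$: for every $x\subseteq\mathcal P$ with $|x|^V=\kappa$ there exists $A\subseteq\mathcal P$ with $|A|^V=\kappa$, $A$ $W$-filtered, and $|x\cap A|=\kappa$. $(\mathrm{G})_{\mathcal P,\kappa}$: for every $\subseteq$-increasing sequence $\langle b_\alpha:\alpha<\kappa\rangle\in V$ with $b_\alpha\in\mathcal P$ for all $\alpha$, the set $\{\delta<\kappa:\bigcup_{\alpha<\delta}b_\alpha\in W\}$ contains a club subset of $\kappa$. A filtration of a set $X$ with $|X|=\kappa$ is a sequence $\langle X_\alpha:\alpha<\kappa\rangle$ with $|X_\alpha|<\kappa$, $X_\alpha\subseteq X_\beta$ for $\alpha<\beta$, $X_\delta=\bigcup_{\alpha<\delta}X_\alpha$ for limit $\delta$, and $X=\bigcup_\alpha X_\alpha$. A set $X\in V$ with $|X|^V=\kappa$, $X\subseteq W$, is $W$-filtered iff it has a filtration with $X_\alpha\in W$ for a club set of $\alpha$. *)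

(* Defs.v *)
Set Implicit Arguments.
Unset Strict Implicit.

(** * Models of ZFC *)

Record set_structure : Type := SetStructure {
  carrier :> Type;
  mem : carrier -> carrier -> Prop
}.
Arguments mem {s} _ _.
Notation "x ∈ y" := (mem x y) (at level 70).

(** First-order formulas over equality, membership and a family [S] of unary
    predicate symbols, with de Bruijn variables.  [S := Empty_set] gives the
    language of set theory. *)
Inductive formula (S : Type) : Type :=
| FEq (i j : nat)
| FMem (i j : nat)
| FPred (s : S) (i : nat)
| FBot
| FAnd (f g : formula S)
| FOr (f g : formula S)
| FImp (f g : formula S)
| FAll (f : formula S)
| FEx (f : formula S).

Definition scons (T : Type) (x : T) (e : nat -> T) (n : nat) : T :=
  match n with O => x | S m => e m end.

Fixpoint sat (M : set_structure) (S : Type) (U : S -> M -> Prop)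
    (e : nat -> M) (f : formula S) : Prop :=
  match f with
  | FEq _ i j => e i = e j
  | FMem _ i j => e i ∈ e j
  | FPred s i => U s (e i)
  | FBot _ => False
  | FAnd f g => sat U e f /\ sat U e g
  | FOr f g => sat U e f \/ sat U e g
  | FImp f g => sat U e f -> sat U e g
  | FAll f => forall x : M, sat U (scons x e) f
  | FEx f => exists x : M, sat U (scons x e) f
  end.

Definition subset (M : set_structure) (x y : M) : Prop :=
  forall z : M, z ∈ x -> z ∈ y.

Definition is_empty (M : set_structure) (x : M) : Prop :=
  forall z : M, ~ z ∈ x.

Definition is_succ (M : set_structure) (y x : M) : Prop :=
  forall z : M, z ∈ y <-> z ∈ x \/ z = x.

(** [ZFC U]: the structure [M], expanded by the unary predicates [U], satisfies
    ZFC, with the two schemas ranging over all formulas of the expanded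
    language; the values of [e] are the parameters. *)
Record ZFC (M : set_structure) (S : Type) (U : S -> M -> Prop) : Prop := {
  zfc_extensionality : forall x y : M,
    (forall z : M, z ∈ x <-> z ∈ y) -> x = y;
  zfc_foundation : forall x : M,
    (exists y : M, y ∈ x) ->
    exists y : M, y ∈ x /\ forall z : M, z ∈ x -> ~ z ∈ y;
  zfc_pairing : forall a b : M,
    exists c : M, forall x : M, x ∈ c <-> x = a \/ x = b;
  zfc_union : forall a : M,
    exists u : M, forall x : M, x ∈ u <-> exists y : M, y ∈ a /\ x ∈ y;
  zfc_powerset : forall a : M,
    exists p : M, forall x : M, x ∈ p <-> subset x a;
  zfc_infinity :
    exists w : M, (exists x : M, is_empty x /\ x ∈ w) /\
      forall x : M, x ∈ w -> exists y : M, is_succ y x /\ y ∈ w;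
  zfc_separation : forall (f : formula S) (e : nat -> M) (a : M),
    exists b : M, forall x : M, x ∈ b <-> x ∈ a /\ sat U (scons x e) f;
  zfc_replacement : forall (f : formula S) (e : nat -> M) (a : M),
    (forall x y z : M, x ∈ a ->
       sat U (scons x (scons y e)) f -> sat U (scons x (scons z e)) f ->
       y = z) ->
    exists b : M, forall y : M,
      y ∈ b <-> exists x : M, x ∈ a /\ sat U (scons x (scons y e)) f;
  zfc_choice : forall a : M,
    (forall x : M, x ∈ a -> exists z : M, z ∈ x) ->
    (forall x y z : M, x ∈ a -> y ∈ a -> z ∈ x -> z ∈ y -> x = y) ->
    exists c : M, forall x : M, x ∈ a -> exists! z : M, z ∈ x /\ z ∈ c
}.

(** * Ordered pairs and functions inside a structure *)

Definition is_upair (M : set_structure) (c a b : M) : Prop :=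
  forall x : M, x ∈ c <-> x = a \/ x = b.

(** Kuratowski pair: [p = {{a}, {a, b}}] *)
Definition is_opair (M : set_structure) (p a b : M) : Prop :=
  forall c : M, c ∈ p <-> is_upair c a a \/ is_upair c a b.

Definition maps (M : set_structure) (f a b : M) : Prop :=
  exists p : M, is_opair p a b /\ p ∈ f.

(** [f] is a function with domain [x]. *)
Definition is_function (M : set_structure) (f x : M) : Prop :=
  (forall p : M, p ∈ f -> exists a b : M, a ∈ x /\ is_opair p a b) /\
  (forall a : M, a ∈ x -> exists! b : M, maps f a b).

Definition is_function_to (M : set_structure) (f x y : M) : Prop :=
  is_function f x /\ forall a b : M, maps f a b -> b ∈ y.

Definition is_bijection (M : set_structure) (f x y : M) : Prop :=
  is_function_to f x y /\
  (forall a a' b : M, maps f a b -> maps f a' b -> a = a') /\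
  (forall b : M, b ∈ y -> exists a : M, maps f a b).

(** * Ordinals and cardinals inside a structure *)

Definition is_transitive (M : set_structure) (a : M) : Prop :=
  forall x : M, x ∈ a -> subset x a.

Definition well_ordered_by_mem (M : set_structure) (a : M) : Prop :=
  (forall x : M, x ∈ a -> ~ x ∈ x) /\
  (forall x y z : M, x ∈ a -> y ∈ a -> z ∈ a -> x ∈ y -> y ∈ z -> x ∈ z) /\
  (forall x y : M, x ∈ a -> y ∈ a -> x ∈ y \/ x = y \/ y ∈ x) /\
  (forall s : M, subset s a -> (exists x : M, x ∈ s) ->
     exists x : M, x ∈ s /\ forall y : M, y ∈ s -> x = y \/ x ∈ y).

Definition is_ordinal (M : set_structure) (a : M) : Prop :=
  is_transitive a /\ well_ordered_by_mem a.

(** Zero does not count as a limit ordinal. *)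
Definition is_limit (M : set_structure) (d : M) : Prop :=
  is_ordinal d /\ (exists a : M, a ∈ d) /\
  (forall a : M, a ∈ d -> exists b : M, b ∈ d /\ a ∈ b).

Definition is_omega (M : set_structure) (w : M) : Prop :=
  is_limit w /\ forall a : M, a ∈ w -> ~ is_limit a.

Definition equinumerous (M : set_structure) (x y : M) : Prop :=
  exists f : M, is_bijection f x y.

Definition is_cardinal (M : set_structure) (k : M) : Prop :=
  is_ordinal k /\ forall a : M, a ∈ k -> ~ equinumerous a k.

(** [|x| = k], computed in [M] *)
Definition has_card (M : set_structure) (x k : M) : Prop :=
  is_cardinal k /\ equinumerous x k.

(** [|x| < k], computed in [M] *)
Definition card_lt (M : set_structure) (x k : M) : Prop :=
  exists m : M, has_card x m /\ m ∈ k.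

Definition cofinal_map (M : set_structure) (f m k : M) : Prop :=
  is_function_to f m k /\
  forall a : M, a ∈ k ->
    exists i b : M, i ∈ m /\ maps f i b /\ (a = b \/ a ∈ b).

Definition is_cofinality (M : set_structure) (k m : M) : Prop :=
  is_ordinal m /\ (exists f : M, cofinal_map f m k) /\
  forall n : M, n ∈ m -> ~ exists f : M, cofinal_map f n k.

Definition is_regular (M : set_structure) (k : M) : Prop :=
  is_cardinal k /\ (exists w : M, is_omega w /\ subset w k) /\
  is_cofinality k k.

Definition is_uncountable_cardinal (M : set_structure) (k : M) : Prop :=
  is_cardinal k /\ exists w : M, is_omega w /\ w ∈ k.

(** * Clubs and sequences of sets *)

Definition is_club (M : set_structure) (C k : M) : Prop :=
  subset C k /\
  (forall a : M, a ∈ k -> exists b : M, b ∈ C /\ a ∈ b) /\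
  (forall d : M, d ∈ k -> is_limit d ->
     (forall a : M, a ∈ d -> exists b : M, b ∈ C /\ b ∈ d /\ a ∈ b) ->
     d ∈ C).

Definition contains_club (M : set_structure) (S : M -> Prop) (k : M) : Prop :=
  exists C : M, is_club C k /\ forall a : M, a ∈ C -> S a.

(** [u] is the union of the values [s(a)] for [a ∈ d]. *)
Definition is_union_below (M : set_structure) (u s d : M) : Prop :=
  forall z : M, z ∈ u <-> exists a y : M, a ∈ d /\ maps s a y /\ z ∈ y.

Definition increasing_seq (M : set_structure) (s k : M) : Prop :=
  is_function s k /\
  forall a b x y : M, b ∈ k -> a ∈ b -> maps s a x -> maps s b y ->
    subset x y.

Definition is_filtration (M : set_structure) (s X k : M) : Prop :=
  increasing_seq s k /\
  (forall a x : M, a ∈ k -> maps s a x -> card_lt x k) /\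
  (forall d x : M, d ∈ k -> is_limit d -> maps s d x -> is_union_below x s d) /\
  is_union_below X s k.

(** * Inner models *)

Definition submodel (V : set_structure) (W : V -> Prop) : set_structure :=
  {| carrier := {x : V | W x};
     mem := fun x y => proj1_sig x ∈ proj1_sig y |}.

(** The class [W] may be mentioned in the schemas of [V], but [W] itself is a
    model of ZFC in the language of membership only. *)
Record inner_model (V : set_structure) (W : V -> Prop) : Prop := {
  inner_ZFC_univ : ZFC (fun _ : unit => W);
  inner_transitive : forall x y : V, W y -> x ∈ y -> W x;
  inner_ordinals : forall a : V, is_ordinal a -> W a;
  inner_ZFC : @ZFC (submodel W) Empty_set (fun s _ => match s with end)
}.

Definition ordinal_in_inner (V : set_structure) (W : V -> Prop)
    (hW : inner_model W) (a : V) (ha : is_ordinal a) : submodel W :=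
  exist W a (inner_ordinals hW ha).

Definition regular_ordinal (M : set_structure) (k : M)
    (hk : is_regular k) : is_ordinal k :=
  proj1 (proj1 hk).

(** [P ⊆ [l]^{<k}], computed in [M] *)
Definition subset_small_powerset (M : set_structure) (P l k : M) : Prop :=
  forall b : M, b ∈ P -> subset b l /\ card_lt b k.

(** * The properties (F) and (G) *)

Definition is_inter (M : set_structure) (c x y : M) : Prop :=
  forall z : M, z ∈ c <-> z ∈ x /\ z ∈ y.

Definition W_filtered (V : set_structure) (W : V -> Prop) (k X : V) : Prop :=
  has_card X k /\ (forall z : V, z ∈ X -> W z) /\
  exists s : V, is_filtration s X k /\
    contains_club (fun a => exists x : V, maps s a x /\ W x) k.

Definition F_property (V : set_structure) (W : V -> Prop) (P k : V) : Prop :=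
  forall x : V, subset x P -> has_card x k ->
    exists A : V, subset A P /\ has_card A k /\ W_filtered W k A /\
      exists c : V, is_inter c x A /\ has_card c k.

Definition G_property (V : set_structure) (W : V -> Prop) (P k : V) : Prop :=
  forall b : V, increasing_seq b k ->
    (forall a x : V, a ∈ k -> maps b a x -> x ∈ P) ->
    contains_club (fun d => exists u : V, is_union_below u b d /\ W u) k.

(* Main.v *)
(** If [b] is eventually constant, all unions far enough out equal its final
    value.  Otherwise the range of [b] has cardinality [kappa], so (F) yields a
    filtered [A], with filtration [s], that contains [b(d)] for cofinally many
    [d].  For club many [d] we have [s(d) ∈ W] and the union of [b] below [d] is
    [⋃ {y ∈ s(d) : y ⊆ b(d)}], which is computed in [W] from [s(d)] and [b(d)].

    [V] may be ill-founded, so recursion has to be done inside [V], by gluing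
    set-sized attempts. *)

From Stdlib Require Import PeanoNat Classical.
Require Import Defs.

Set Implicit Arguments.
Unset Strict Implicit.

(** * Definability with parameters *)

(** Neither [b] nor the filtration [s] need belong to [W]; only single values of them do. So the
    union below [d] has to be recovered from the two sets [s(d)] and [b(d)] alone. The condition
    [y ⊆ b(d)] replaces the condition that [y] be an earlier value of [b], which [W] cannot express;
    the price is that [s(d)] may contain sets that are no values of [b], and the choice of the club
    has to make them harmless. The axiom schemas speak of formulas, so separation, replacement and
    even induction along [k] apply only to predicates given by a formula with parameters.
    [definable] records this, and its closure lemmas reduce each use to inspecting the shape of the
    predicate. Recursion serves two ends: enumerating an unbounded subset of [k] in order type [k],
    and finding closure points of a relation on [k]. Both times the next value is the least suitable
    ordinal, so one recursion with two parameters covers them. *)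

Fixpoint rename (S : Type) (r : nat -> nat) (f : formula S) : formula S :=
  let up r := scons 0 (fun n => Datatypes.S (r n)) in
  match f with
  | FEq _ i j => FEq S (r i) (r j)
  | FMem _ i j => FMem S (r i) (r j)
  | FPred s i => FPred s (r i)
  | FBot _ => FBot S
  | FAnd f g => FAnd (rename r f) (rename r g)
  | FOr f g => FOr (rename r f) (rename r g)
  | FImp f g => FImp (rename r f) (rename r g)
  | FAll f => FAll (rename (up r) f)
  | FEx f => FEx (rename (up r) f)
  end.

Lemma sat_rename (M : set_structure) (S : Type) (U : S -> M -> Prop)
    (f : formula S) (r : nat -> nat) (e e' : nat -> M) :
  (forall i, e' i = e (r i)) -> (sat U e (rename r f) <-> sat U e' f).
Proof.
  revert r e e'.
  induction f; intros r e e' he; simpl; rewrite ?he; try tauto;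
    try (rewrite (IHf1 r e e' he), (IHf2 r e e' he); tauto).
  - split; intros h x; specialize (h x);
      apply (IHf (scons 0 (fun n => Datatypes.S (r n))) (scons x e) (scons x e'));
      try assumption;
      intros [|i]; simpl; auto.
  - split; intros [x h]; exists x;
      apply (IHf (scons 0 (fun n => Datatypes.S (r n))) (scons x e) (scons x e'));
      try assumption;
      intros [|i]; simpl; auto.
Qed.

Definition interleave (T : Type) (e p : nat -> T) (n : nat) : T :=
  if Nat.even n then e (Nat.div2 n) else p (Nat.div2 n).

Lemma interleave_even (T : Type) (e p : nat -> T) (k : nat) :
  interleave e p (2 * k) = e k.
Proof.
  unfold interleave. now rewrite Nat.even_even, Nat.div2_double.
Qed.

Lemma interleave_odd (T : Type) (e p : nat -> T) (k : nat) :
  interleave e p (S (2 * k)) = p k.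
Proof.
  unfold interleave.
  now rewrite Nat.even_succ, Nat.odd_even, Nat.div2_succ_double.
Qed.

(** Renamings are interleaved in the same way as environments, so checking a renaming splits into a
    check on variables and one on parameters. *)
Lemma interleave_comp (T : Type) (e p g : nat -> T) (r1 r2 : nat -> nat) :
  (forall k, e k = g (r1 k)) -> (forall k, p k = g (r2 k)) ->
  forall i, interleave e p i = g (interleave r1 r2 i).
Proof.
  intros h1 h2 i. unfold interleave. now destruct (Nat.even i).
Qed.

Section Definability.

Context (M : set_structure) (S : Type) (U : S -> M -> Prop).

(** [v g i] is the value of the variable [i] in the context [g]; parameters
    from [M] are kept apart, at the odd positions of the environment, so that
    two formulas with different parameters can be combined. *)
Definition definable (G : Type) (v : G -> nat -> M) (Q : G -> Prop) : Prop :=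
  exists (f : formula S) (p : nat -> M),
    forall g, sat U (interleave (v g) p) f <-> Q g.

Definition context1 (x : M) (_ : nat) : M := x.

Definition extend (G : Type) (v : G -> nat -> M) (g : G * M) : nat -> M :=
  scons (snd g) (v (fst g)).

Definition definable1 (Q : M -> Prop) : Prop := definable context1 Q.

Definition definable2 (Q : M -> M -> Prop) : Prop :=
  definable (extend context1) (fun g => Q (fst g) (snd g)).

Section Closure.

Context (G : Type) (v : G -> nat -> M).

Lemma definable_combine (op : Prop -> Prop -> Prop)
    (fop : formula S -> formula S -> formula S) (P Q : G -> Prop) :
  (forall e f1 f2, sat U e (fop f1 f2) = op (sat U e f1) (sat U e f2)) ->
  (forall A A' B B', (A <-> A') -> (B <-> B') -> (op A B <-> op A' B')) ->
  definable v P -> definable v Q -> definable v (fun g => op (P g) (Q g)).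
Proof.
  intros hop hiff [f1 [p1 h1]] [f2 [p2 h2]].
  (* Variables keep their places. The merged stream [interleave p1 p2] holds parameter [k] of [f1]
     in slot [2k] and that of [f2] in slot [2k+1]. *)
  exists (fop (rename (interleave (fun k => 2 * k) (fun k => 1 + 2 * (2 * k))) f1)
              (rename (interleave (fun k => 2 * k) (fun k => 1 + 2 * (1 + 2 * k))) f2)),
         (interleave p1 p2).
  intro g. rewrite hop. apply hiff.
  - rewrite <- h1. apply sat_rename.
    apply interleave_comp; intro k; symmetry.
    + apply interleave_even.
    + cbn -[Nat.mul]. now rewrite interleave_odd, interleave_even.
  - rewrite <- h2. apply sat_rename.
    apply interleave_comp; intro k; symmetry.
    + apply interleave_even.
    + cbn -[Nat.mul]. now rewrite interleave_odd, interleave_odd.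
Qed.

Lemma definable_and (P Q : G -> Prop) :
  definable v P -> definable v Q -> definable v (fun g => P g /\ Q g).
Proof. apply (definable_combine (fop := @FAnd S)); simpl; tauto. Qed.

Lemma definable_or (P Q : G -> Prop) :
  definable v P -> definable v Q -> definable v (fun g => P g \/ Q g).
Proof. apply (definable_combine (fop := @FOr S)); simpl; tauto. Qed.

Lemma definable_imp (P Q : G -> Prop) :
  definable v P -> definable v Q -> definable v (fun g => P g -> Q g).
Proof.
  apply (definable_combine (op := fun A B => A -> B) (fop := @FImp S));
    simpl; tauto.
Qed.

Lemma definable_iff (P Q : G -> Prop) :
  definable v P -> definable v Q -> definable v (fun g => P g <-> Q g).
Proof. intros; apply definable_and; apply definable_imp; assumption. Qed.

Lemma definable_not (P : G -> Prop) :
  definable v P -> definable v (fun g => ~ P g).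
Proof.
  intro hP. apply (definable_imp (Q := fun _ => False)); [exact hP|].
  (* The carrier might be empty for all that is known here, so the parameter stream for [FBot] is
     borrowed from [P]. *)
  destruct hP as [_ [p _]]. exists (FBot S), p. simpl. tauto.
Qed.

(** A quantifier puts [x] in front of the whole interleaved environment, whereas [extend] puts it in
    front of the variables only. The renaming translates: old variable [k] now sits at [1+2k],
    parameter [k] at [1+(1+2k)]. *)
Lemma interleave_scons (e p : nat -> M) (x : M) (i : nat) :
  interleave (scons x e) p i =
  scons x (interleave e p)
    (interleave (scons 0 (fun k => 1 + 2 * k)) (fun k => 1 + (1 + 2 * k)) i).
Proof.
  revert i.
  apply (interleave_comp (g := scons x (interleave e p))).
  - intros [|k]; cbn -[Nat.mul]; [reflexivity|].
    now rewrite interleave_even.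
  - intro k; cbn -[Nat.mul]. now rewrite interleave_odd.
Qed.

Lemma definable_forall (Q : G -> M -> Prop) :
  definable (extend v) (fun g => Q (fst g) (snd g)) ->
  definable v (fun g => forall x, Q g x).
Proof.
  intros [f [p h]].
  exists (FAll (rename (interleave (scons 0 (fun k => 1 + 2 * k))
                          (fun k => 1 + (1 + 2 * k))) f)), p.
  intro g; simpl. split; intros hx x; specialize (hx x).
  - apply (h (g, x)). revert hx. apply sat_rename.
    intro i. apply interleave_scons.
  - apply (h (g, x)) in hx. revert hx. apply sat_rename.
    intro i. apply interleave_scons.
Qed.

Lemma definable_exists (Q : G -> M -> Prop) :
  definable (extend v) (fun g => Q (fst g) (snd g)) ->
  definable v (fun g => exists x, Q g x).
Proof.
  intros [f [p h]].
  exists (FEx (rename (interleave (scons 0 (fun k => 1 + 2 * k))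
                          (fun k => 1 + (1 + 2 * k))) f)), p.
  intro g; simpl. split; intros [x hx]; exists x.
  - apply (h (g, x)). revert hx. apply sat_rename.
    intro i. apply interleave_scons.
  - apply (h (g, x)) in hx. revert hx. apply sat_rename.
    intro i. apply interleave_scons.
Qed.

Definition is_term (t : G -> M) : Prop :=
  (exists i, forall g, t g = v g i) \/ (exists c, forall g, t g = c).

(** A constant can be stored in any parameter slot [m] that the caller reserves. For a variable the
    slot is irrelevant, and [m0] merely fills it. *)
Lemma is_term_index (m0 : M) (t : G -> M) : is_term t ->
  exists c : M, forall m : nat, exists i : nat, forall p : nat -> M,
    p m = c -> forall g, t g = interleave (v g) p i.
Proof.
  intros [[i h]|[c h]].
  - exists m0. intro m. exists (2 * i). intros p _ g.
    now rewrite interleave_even, h.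
  - exists c. intro m. exists (1 + 2 * m). intros p hp g.
    cbn -[Nat.mul]. now rewrite interleave_odd, h.
Qed.

Lemma definable_apply2 (Q : M -> M -> Prop) (t1 t2 : G -> M) :
  definable2 Q -> is_term t1 -> is_term t2 ->
  definable v (fun g => Q (t1 g) (t2 g)).
Proof.
  intros [f [p h]] h1 h2.
  destruct (is_term_index (p 0) h1) as [c1 hc1].
  destruct (is_term_index (p 0) h2) as [c2 hc2].
  destruct (hc1 0) as [i1 hi1]. destruct (hc2 1) as [i2 hi2].
  (* Slots 0 and 1 are reserved for the two terms, and the old parameters move up by two. Variable 0
     is the second argument of [Q], since [extend] puts the newest entry first. *)
  set (p' := scons c1 (scons c2 p)).
  exists (rename (interleave (scons i2 (fun _ => i1))
                    (fun k => 1 + 2 * (2 + k))) f), p'.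
  intro g. rewrite <- (h (t1 g, t2 g)). apply sat_rename.
  apply interleave_comp.
  - intros [|k]; simpl; [apply hi2|apply hi1]; reflexivity.
  - intro k. cbn -[Nat.mul Nat.add].
    now rewrite (interleave_odd _ _ (2 + k)).
Qed.

Lemma definable_apply1 (Q : M -> Prop) (t : G -> M) :
  definable1 Q -> is_term t -> definable v (fun g => Q (t g)).
Proof.
  intros [f [p h]] h1.
  destruct (is_term_index (p 0) h1) as [c1 hc1].
  destruct (hc1 0) as [i1 hi1].
  exists (rename (interleave (fun _ => i1) (fun k => 1 + 2 * (1 + k))) f),
    (scons c1 p).
  intro g. rewrite <- (h (t g)). apply sat_rename.
  apply interleave_comp.
  - intro k; simpl; apply hi1; reflexivity.
  - intro k. cbn -[Nat.mul Nat.add].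
    now rewrite (interleave_odd _ _ (1 + k)).
Qed.

End Closure.

Lemma zfc_inhabited (hZ : ZFC U) : exists m : M, True.
Proof. destruct (zfc_infinity hZ) as [w _]. now exists w. Qed.

Lemma definable2_mem (hZ : ZFC U) : definable2 (fun x y => x ∈ y).
Proof.
  destruct (zfc_inhabited hZ) as [m _].
  exists (FMem S 2 0), (fun _ => m). reflexivity.
Qed.

Lemma definable2_eq (hZ : ZFC U) : definable2 (fun x y => x = y).
Proof.
  destruct (zfc_inhabited hZ) as [m _].
  exists (FEq S 2 0), (fun _ => m). reflexivity.
Qed.

Lemma definable_separation (hZ : ZFC U) (Q : M -> Prop) (a : M) :
  definable1 Q -> exists b : M, forall x, x ∈ b <-> x ∈ a /\ Q x.
Proof.
  intros [f [p h]].
  destruct (zfc_separation hZ (rename (interleave (fun _ => 0) (fun k => 1 + k)) f)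
    p a) as [b hb].
  exists b. intro x. rewrite hb, <- (h x).
  enough (forall i, interleave (context1 x) p i =
    scons x p (interleave (fun _ => 0) (fun k => 1 + k) i)) as he
    by (rewrite (sat_rename U f he); tauto).
  apply interleave_comp; reflexivity.
Qed.

Lemma definable_replacement (hZ : ZFC U) (Q : M -> M -> Prop) (a : M) :
  definable2 Q ->
  (forall x y z : M, x ∈ a -> Q x y -> Q x z -> y = z) ->
  exists b : M, forall y : M, y ∈ b <-> exists x : M, x ∈ a /\ Q x y.
Proof.
  intros [f [p h]] huniq.
  (* The replacement axiom has [x] at 0, [y] at 1 and parameters from 2 on, while in [definable2]
     variable 0 is [y] and the later ones are [x]. *)
  set (r := interleave (scons 1 (fun _ => 0)) (fun k => 2 + k)).
  assert (hs : forall x y, sat U (scons x (scons y p)) (rename r f) <-> Q x y).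
  { intros x y. rewrite <- (h (x, y)). apply sat_rename.
    apply interleave_comp; [intros [|k]|]; reflexivity. }
  destruct (zfc_replacement hZ (f := rename r f) (e := p) (a := a)) as [b hb].
  - intros x y z hx hy hz. apply hs in hy, hz. exact (huniq x y z hx hy hz).
  - exists b. intro y. rewrite hb.
    split; intros [x [hx hy]]; exists x; split; try assumption; now apply hs.
Qed.

End Definability.

(* Automation for definability goals *)
Create HintDb set_theory.
#[local] Hint Unfold is_upair is_opair maps subset is_limit : set_theory.

Ltac solve_variable fuel i :=
  match fuel with
  | Datatypes.S ?n =>
      first [ left; exists i; intro; reflexivity
            | solve_variable n (Datatypes.S i) ]
  end.

Ltac solve_term :=
  first [ right; eexists; intro; reflexivity | solve_variable 30 0 ].

Ltac definability_step :=
  match goal with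
  | |- definable _ _ (fun g => _ <-> _) => apply definable_iff
  | |- definable _ _ (fun g => _ /\ _) => apply definable_and
  | |- definable _ _ (fun g => _ \/ _) => apply definable_or
  | |- definable _ _ (fun g => ~ _) => apply definable_not
  | |- definable _ _ (fun g => exists x, _) => apply definable_exists
  | h : ZFC _ |- definable _ _ (fun g => @mem _ (@?a g) (@?b g)) =>
      apply (@definable_apply2 _ _ _ _ _ _ a b (definable2_mem h)); solve_term
  | h : ZFC _ |- definable _ _ (fun g => @eq _ (@?a g) (@?b g)) =>
      apply (@definable_apply2 _ _ _ _ _ _ a b (definable2_eq h)); solve_term
  | h : definable2 _ ?Q |- definable _ _ (fun g => ?Q (@?a g) (@?b g)) =>
      apply (@definable_apply2 _ _ _ _ _ Q a b h); solve_term
  | h : definable1 _ ?Q |- definable _ _ (fun g => ?Q (@?a g)) =>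
      apply (@definable_apply1 _ _ _ _ _ Q a h); solve_term
  | |- definable _ _ (fun g => _ -> _) => apply definable_imp
  | |- definable _ _ (fun g => forall x, _) => apply definable_forall
  | |- definable _ _ _ => assumption
  end; cbv beta.

Ltac definability :=
  autounfold with set_theory; unfold definable1, definable2; cbv beta;
  repeat definability_step.

(** * Regular cardinals inside a model *)

Section SetTheory.

Context (M : set_structure) (S : Type) (U : S -> M -> Prop) (hZ : ZFC U).

Lemma upair_exists (a b : M) : exists c : M, is_upair c a b.
Proof. exact (zfc_pairing hZ a b). Qed.

Lemma opair_exists (a b : M) : exists p : M, is_opair p a b.
Proof.
  destruct (upair_exists a a) as [c hc], (upair_exists a b) as [d hd].
  destruct (upair_exists c d) as [p hp].
  exists p. intro x. rewrite (hp x).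
  split; (intros [h|h]; [left|right]).
  - now subst.
  - now subst.
  - apply (zfc_extensionality hZ). intro z. now rewrite (h z), (hc z).
  - apply (zfc_extensionality hZ). intro z. now rewrite (h z), (hd z).
Qed.

Lemma opair_unique (p q a b : M) : is_opair p a b -> is_opair q a b -> p = q.
Proof.
  intros hp hq. apply (zfc_extensionality hZ). intro z.
  now rewrite (hp z), (hq z).
Qed.

Lemma opair_inj (p a b a' b' : M) :
  is_opair p a b -> is_opair p a' b' -> a = a' /\ b = b'.
Proof.
  intros h h'.
  assert (ha : a = a').
  { destruct (upair_exists a a) as [c hc].
    assert (hcp : c ∈ p) by (apply h; now left).
    apply h' in hcp.
    assert (a' ∈ c) as hx
      by (destruct hcp as [e|e]; apply e; now left).
    apply hc in hx. destruct hx; congruence. }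
  subst a'. split; [reflexivity|].
  destruct (upair_exists a b) as [c hc], (upair_exists a b') as [c' hc'].
  assert (hcp : c ∈ p) by (apply h; now right).
  assert (hcp' : c' ∈ p) by (apply h'; now right).
  apply h' in hcp. apply h in hcp'.
  assert (hb : b = a \/ b = b').
  { assert (hx : b ∈ c) by (apply hc; now right).
    destruct hcp as [e|e]; apply e in hx; tauto. }
  assert (hb' : b' = a \/ b' = b).
  { assert (hx : b' ∈ c') by (apply hc'; now right).
    destruct hcp' as [e|e]; apply e in hx; tauto. }
  destruct hb, hb'; congruence.
Qed.

(** Replacement is applied to [x ↦ (x, y)]. Totality is left out because the attempts of the
    recursion are partial functions on [k]. *)
Lemma graph_exists (D : M) (Q : M -> M -> Prop) :
  definable2 U Q ->
  (forall x y z, x ∈ D -> Q x y -> Q x z -> y = z) ->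
  exists F : M,
    (forall p, p ∈ F -> exists a b, a ∈ D /\ is_opair p a b) /\
    forall x y, maps F x y <-> x ∈ D /\ Q x y.
Proof.
  intros hQ hun.
  destruct (@definable_replacement _ _ _ hZ
    (fun x p => exists y, is_opair p x y /\ Q x y) D) as [F hF].
  - definability.
  - intros x p q hx [y [hp hy]] [z [hq hz]].
    rewrite (hun x z y hx hz hy) in hq. exact (opair_unique hp hq).
  - exists F. split.
    + intros p hp. apply hF in hp. destruct hp as [x [hx [y [hp _]]]].
      now exists x, y.
    + intros x y. split.
      * intros [p [hp hpF]]. apply hF in hpF.
        destruct hpF as [x' [hx [y' [hp' hy]]]].
        destruct (opair_inj hp hp') as [<- <-]. now split.
      * intros [hx hy]. destruct (opair_exists x y) as [p hp].
        exists p. split; [exact hp|]. apply hF. exists x. split; [exact hx|].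
        now exists y.
Qed.

Lemma function_exists (D : M) (Q : M -> M -> Prop) :
  definable2 U Q ->
  (forall x y z, x ∈ D -> Q x y -> Q x z -> y = z) ->
  (forall x, x ∈ D -> exists y, Q x y) ->
  exists F : M, is_function F D /\ forall x y, maps F x y <-> x ∈ D /\ Q x y.
Proof.
  intros hQ hun hex. destruct (graph_exists hQ hun) as [F [hF1 hF2]].
  exists F. split; [split; [exact hF1|]|exact hF2].
  intros a ha. destruct (hex a ha) as [y hy].
  exists y. split; [now apply hF2|].
  intros z hz. apply hF2 in hz. exact (hun a y z ha hy (proj2 hz)).
Qed.

Lemma function_value (f D a : M) :
  is_function f D -> a ∈ D -> exists y, maps f a y.
Proof. intros [_ h] ha. destruct (h a ha) as [y [hy _]]. now exists y. Qed.

Lemma function_domain (f D a b : M) : is_function f D -> maps f a b -> a ∈ D.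
Proof.
  intros [h _] [p [hp hpf]]. destruct (h p hpf) as [a' [b' [ha' hp']]].
  now destruct (opair_inj hp hp') as [-> _].
Qed.

Lemma function_unique (f D a b b' : M) :
  is_function f D -> maps f a b -> maps f a b' -> b = b'.
Proof.
  intros hf hb hb'.
  destruct (proj2 hf a (function_domain hf hb)) as [y [_ hy]].
  now rewrite <- (hy b hb), <- (hy b' hb').
Qed.

(** * Ordinals below a regular cardinal *)

Section Regular.

Context (k : M) (hk : is_regular k).

Lemma ord_trans (a b : M) : a ∈ b -> b ∈ k -> a ∈ k.
Proof. intros ha hb. exact (proj1 (proj1 (proj1 hk)) b hb a ha). Qed.

Lemma ord_irrefl (a : M) : a ∈ k -> ~ a ∈ a.
Proof. exact (proj1 (proj2 (proj1 (proj1 hk))) a). Qed.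

Lemma ord_mem_trans (a b c : M) : a ∈ b -> b ∈ c -> c ∈ k -> a ∈ c.
Proof.
  intros ha hb hc. pose proof (ord_trans hb hc) as hb'.
  pose proof (ord_trans ha hb') as ha'.
  exact (proj1 (proj2 (proj2 (proj1 (proj1 hk)))) a b c ha' hb' hc ha hb).
Qed.

Lemma ord_total (a b : M) : a ∈ k -> b ∈ k -> a ∈ b \/ a = b \/ b ∈ a.
Proof.
  exact (proj1 (proj2 (proj2 (proj2 (proj1 (proj1 hk))))) a b).
Qed.

Definition ord_le (a b : M) : Prop := a = b \/ a ∈ b.

Lemma ord_not_mem (a b : M) : a ∈ k -> b ∈ k -> ~ a ∈ b -> ord_le b a.
Proof.
  intros ha hb h. destruct (ord_total ha hb) as [h'|[h'|h']];
    [contradiction|left; now symmetry|now right].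
Qed.

Lemma ord_le_mem (a b c : M) : ord_le a b -> b ∈ c -> c ∈ k -> a ∈ c.
Proof.
  intros [->|h] hb hc; [exact hb|exact (ord_mem_trans h hb hc)].
Qed.

Lemma ord_mem_le (a b c : M) : a ∈ b -> ord_le b c -> c ∈ k -> a ∈ c.
Proof.
  intros ha [<-|h] hc; [exact ha|exact (ord_mem_trans ha h hc)].
Qed.

Lemma least_ordinal (Q : M -> Prop) : definable1 U Q ->
  (exists a, a ∈ k /\ Q a) ->
  exists a, a ∈ k /\ Q a /\ forall b, b ∈ k -> Q b -> ord_le a b.
Proof.
  intros hQ [a [ha hqa]].
  destruct (definable_separation hZ k hQ) as [s hs].
  destruct (proj2 (proj2 (proj2 (proj2 (proj1 (proj1 hk))))) s) as [m [hm hmin]].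
  - intros x hx. now apply hs in hx.
  - exists a. now apply hs.
  - apply hs in hm. exists m. split; [|split]; try tauto.
    intros b hb hqb. apply hmin. now apply hs.
Qed.

(** Take a least counterexample. Only subsets of [k] that are elements of [M] have least elements,
    hence the definability of [Q]. *)
Lemma ordinal_induction (Q : M -> Prop) : definable1 U Q ->
  (forall a, a ∈ k -> (forall b, b ∈ a -> Q b) -> Q a) ->
  forall a, a ∈ k -> Q a.
Proof.
  intros hQ hstep a ha. apply NNPP. intro hna.
  destruct (@least_ordinal (fun a => ~ Q a)) as [m [hm [hqm hmin]]].
  - definability.
  - now exists a.
  - apply hqm. apply hstep; [exact hm|]. intros b hb. apply NNPP. intro hqb.
    pose proof (ord_trans hb hm) as hbk.
    destruct (hmin b hbk hqb) as [->|h].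
    + exact (ord_irrefl hbk hb).
    + exact (ord_irrefl hm (ord_mem_trans h hb hm)).
Qed.

(** The working form of regularity. Taking the least witness for each [i] gives a function from [n]
    to [k] without choice; it is not cofinal, and an ordinal at which cofinality fails is a strict
    bound. *)
Lemma regular_bounded (n : M) (Q : M -> M -> Prop) :
  n ∈ k -> definable2 U Q ->
  (forall i, i ∈ n -> exists a, a ∈ k /\ Q i a) ->
  exists c, c ∈ k /\ forall i, i ∈ n -> exists a, a ∈ c /\ Q i a.
Proof.
  intros hn hQ hex.
  set (R := fun i a => a ∈ k /\ Q i a /\ forall b, b ∈ k -> Q i b -> ord_le a b).
  assert (hRun : forall x y z, x ∈ n -> R x y -> R x z -> y = z).
  { intros x y z _ [hy [hqy hmy]] [hz [hqz hmz]].
    destruct (hmy z hz hqz) as [h|h]; [exact h|].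
    destruct (hmz y hy hqy) as [h'|h']; [now symmetry|].
    destruct (ord_irrefl hz (ord_mem_trans h' h hz)). }
  destruct (@function_exists n R) as [F [hF hmaps]].
  - unfold R, ord_le. definability.
  - exact hRun.
  - intros i hi. apply (@least_ordinal (fun a => Q i a)); [definability|].
    now apply hex.
  - apply NNPP. intro hno.
    apply (proj2 (proj2 (proj2 (proj2 hk))) n hn). exists F. split.
    + split; [exact hF|]. intros a b hab. apply hmaps in hab. exact (proj1 (proj2 hab)).
    + intros a ha. apply NNPP. intro hna. apply hno.
      exists a. split; [exact ha|]. intros i hi.
      destruct (function_value hF hi) as [b hb].
      exists b. pose proof (proj2 (proj1 (hmaps i b) hb)) as [hbk [hqb _]].
      split; [|exact hqb].
      destruct (ord_total ha hbk) as [h|[h|h]]; [| |exact h];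
        exfalso; apply hna; exists i, b; tauto.
Qed.

Context (hunc : is_uncountable_cardinal k).

(** A strict bound for the constant map with value [a]; [ω] serves as a nonempty index set below
    [k]. *)
Lemma regular_no_max (a : M) : a ∈ k -> exists b, b ∈ k /\ a ∈ b.
Proof.
  intro ha. destruct hunc as [_ [w [hw hwk]]].
  destruct (@regular_bounded w (fun _ x => x = a)) as [c [hc h]].
  - exact hwk.
  - definability.
  - intros i _. now exists a.
  - destruct hw as [[_ [[z hz] _]] _]. destruct (h z hz) as [x [hx ->]].
    now exists c.
Qed.

Lemma regular_directed (a b : M) :
  a ∈ k -> b ∈ k -> exists c, c ∈ k /\ a ∈ c /\ b ∈ c.
Proof.
  intros ha hb. destruct (ord_total ha hb) as [h|[h|h]].
  - destruct (regular_no_max hb) as [c [hc hbc]].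
    exists c. split; [exact hc|]. split; [|exact hbc].
    exact (ord_mem_trans h hbc hc).
  - subst b. destruct (regular_no_max ha) as [c [hc hac]]. now exists c.
  - destruct (regular_no_max ha) as [c [hc hac]].
    exists c. split; [exact hc|]. split; [exact hac|].
    exact (ord_mem_trans h hac hc).
Qed.

Lemma card_lt_bounded (X : M) (Q : M -> M -> Prop) :
  card_lt X k -> definable2 U Q ->
  (forall x, x ∈ X -> exists a, a ∈ k /\ Q x a) ->
  exists c, c ∈ k /\ forall x, x ∈ X -> exists a, a ∈ c /\ Q x a.
Proof.
  intros [m [[_ [g [[hg hgm] [ginj gsurj]]]] hm]] hQ hex.
  destruct (@regular_bounded m (fun i a => exists x, maps g x i /\ Q x a))
    as [c [hc h]].
  - exact hm.
  - definability.
  - intros i hi. destruct (gsurj i hi) as [x hx].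
    destruct (hex x (function_domain hg hx)) as [a [ha hqa]].
    exists a. split; [exact ha|]. now exists x.
  - exists c. split; [exact hc|]. intros x hx.
    destruct (function_value hg hx) as [i hi].
    destruct (h i (hgm x i hi)) as [a [ha [x' [hx' hqa]]]].
    exists a. split; [exact ha|]. now rewrite (ginj x x' i hi hx').
Qed.

(** * Recursion along the cardinal *)

Section Recursion.

Context (T : M -> Prop) (N : M -> M -> Prop).
Context (hT : definable1 U T) (hN : definable2 U N).
Context (T_unbounded : forall a, a ∈ k -> exists x, x ∈ k /\ T x /\ a ∈ x).
Context (N_bounded : forall y, y ∈ k -> exists x, x ∈ k /\ N y x).
Context (N_upward : forall y x x', x' ∈ k -> N y x -> x ∈ x' -> N y x').

(** The value at [a] will be the least [x] in [T] with [N y x] for all earlier values [y]. [N] being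
    membership gives the increasing enumeration of [T]; an [N] that closes off under a relation
    gives closure points. *)
Definition above (F : M -> M -> Prop) (a x : M) : Prop :=
  x ∈ k /\ T x /\ forall b y, b ∈ a -> F b y -> N y x.

Definition least_above (F : M -> M -> Prop) (a x : M) : Prop :=
  above F a x /\ forall x', above F a x' -> ord_le x x'.

Lemma least_above_ext (F F' : M -> M -> Prop) (a x : M) :
  (forall b y, b ∈ a -> (F b y <-> F' b y)) ->
  least_above F a x -> least_above F' a x.
Proof.
  intros h [[hx [hTx hax]] hmin]. split.
  - split; [exact hx|split; [exact hTx|]].
    intros b y hb hy. apply (hax b y hb). now apply h.
  - intros x' [hx' [hTx' hax']]. apply hmin.
    split; [exact hx'|split; [exact hTx'|]].
    intros b y hb hy. apply (hax' b y hb). now apply h.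
Qed.

Lemma least_above_unique (F : M -> M -> Prop) (a x x' : M) :
  least_above F a x -> least_above F a x' -> x = x'.
Proof.
  intros [hx hmin] [hx' hmin'].
  destruct (hmin x' hx') as [h|h]; [exact h|].
  destruct (hmin' x hx) as [h'|h']; [now symmetry|].
  destruct (ord_irrefl (proj1 hx) (ord_mem_trans h h' (proj1 hx))).
Qed.

(** A set coding an initial piece of the recursion: its domain is closed downwards, and each value
    obeys the recursion clause. Single-valuedness follows from [least_above_unique]. *)
Definition attempt (p : M) : Prop :=
  forall a x, maps p a x ->
    a ∈ k /\ (forall b, b ∈ a -> exists y, maps p b y) /\
    least_above (maps p) a x.

(** Attempts are elements of [M], so the quantifiers over [p] and [q] stay inside a formula in [a]
    and induction applies. *)
Lemma attempt_agree (a : M) : a ∈ k -> forall p q x x',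
  attempt p -> attempt q -> maps p a x -> maps q a x' -> x = x'.
Proof.
  revert a. refine (@ordinal_induction _ _ _).
  - unfold attempt, least_above, above, ord_le. definability.
  - intros a ha IH p q x x' hp hq hx hx'.
    destruct (hp a x hx) as [_ [hpa hpx]].
    destruct (hq a x' hx') as [_ [hqa hqx]].
    apply (@least_above_unique (maps q) a); [|exact hqx].
    apply (least_above_ext (F := maps p)); [|exact hpx].
    intros b y hb.
    destruct (hpa b hb) as [z hz], (hqa b hb) as [z' hz'].
    split; intro hy.
    + now rewrite (IH b hb p q y z' hp hq hy hz').
    + now rewrite <- (IH b hb p q z y hp hq hz hy).
Qed.

Definition rec_value (a x : M) : Prop := exists p, attempt p /\ maps p a x.

Lemma rec_value_definable : definable2 U rec_value.
Proof. unfold rec_value, attempt, least_above, above, ord_le. definability. Qed.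

Lemma rec_value_domain (a x : M) : rec_value a x -> a ∈ k.
Proof. intros [p [hp hx]]. exact (proj1 (hp a x hx)). Qed.

Lemma rec_value_unique (a x x' : M) :
  rec_value a x -> rec_value a x' -> x = x'.
Proof.
  intros hx hx'. pose proof (rec_value_domain hx) as ha.
  destruct hx as [p [hp hx]], hx' as [q [hq hx']].
  exact (attempt_agree ha hp hq hx hx').
Qed.

Lemma rec_value_least (a x : M) : rec_value a x -> least_above rec_value a x.
Proof.
  intros [p [hp hx]]. destruct (hp a x hx) as [ha [hpa hmin]].
  apply (least_above_ext (F := maps p)); [|exact hmin].
  intros b y hb. split.
  - intro hy. now exists p.
  - intro hy. destruct (hpa b hb) as [z hz].
    rewrite (@rec_value_unique b y z hy); [exact hz|now exists p].
Qed.

Lemma least_above_exists (F : M -> M -> Prop) (a : M) :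
  definable2 U F -> a ∈ k -> (forall b y y', F b y -> F b y' -> y = y') ->
  (forall b y, F b y -> y ∈ k) -> exists x, least_above F a x.
Proof.
  intros hF ha hun hval.
  (* Where [F] has no value at [b] the condition is vacuous, and [a] itself is supplied as the
     witness. *)
  destruct (@regular_bounded a (fun b x => forall y, F b y -> N y x))
    as [c [hc h]].
  - exact ha.
  - definability.
  - intros b hb. destruct (classic (exists y, F b y)) as [[y hy]|hno].
    + destruct (N_bounded (hval b y hy)) as [x [hx hyx]].
      exists x. split; [exact hx|]. intros y' hy'.
      now rewrite (hun b y' y hy' hy).
    + exists a. split; [exact ha|]. intros y hy. destruct hno. now exists y.
  - destruct (@least_ordinal (above F a)) as [x [hx [hax hmin]]].
    + unfold above. definability.
    + destruct (T_unbounded hc) as [x [hx [hTx hcx]]].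
      exists x. split; [exact hx|]. split; [exact hx|]. split; [exact hTx|].
      intros b y hb hy. destruct (h b hb) as [x' [hx' hN']].
      apply (@N_upward y x' x hx (hN' y hy)).
      exact (ord_mem_trans hx' hcx hx).
    + exists x. split; [exact hax|]. intros x' hx'.
      exact (hmin x' (proj1 hx') hx').
Qed.

Lemma rec_value_total (a : M) : a ∈ k -> exists x, rec_value a x.
Proof.
  pose proof rec_value_definable as hrec.
  revert a. refine (@ordinal_induction _ _ _).
  - definability.
  - intros a ha IH.
    destruct (@least_above_exists rec_value a hrec ha) as [x hx].
    { exact rec_value_unique. }
    { intros b y hy. exact (proj1 (proj1 (rec_value_least hy))). }
    (* The new attempt: all recursion values below [a], together with the pair [(a, x)]. *)
    destruct (@graph_exists k
      (fun b y => b ∈ a /\ rec_value b y \/ b = a /\ y = x)) as [p [_ hp]].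
    + definability.
    + intros b y z hb [[hba hy]|[-> ->]] [[hba' hz]|[e ->]].
      * exact (rec_value_unique hy hz).
      * subst b. destruct (ord_irrefl ha hba).
      * destruct (ord_irrefl ha hba').
      * reflexivity.
    + assert (hpb : forall b y, b ∈ a -> (rec_value b y <-> maps p b y)).
      { intros b y hb. rewrite hp. split.
        - intro hy. split; [exact (ord_trans hb ha)|now left].
        - intros [_ [[_ hy]|[-> _]]]; [exact hy|].
          destruct (ord_irrefl ha hb). }
      exists x, p. split; [|apply hp; now split; [|right]].
      intros b y hy. apply hp in hy.
      destruct hy as [hb [[hba hy]|[-> ->]]].
      * split; [exact hb|split].
        -- intros b' hb'. assert (hba' : b' ∈ a) by exact (ord_mem_trans hb' hba ha).
           destruct (IH b' hba') as [y' hy'].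
           exists y'. now apply hpb.
        -- apply (least_above_ext (F := rec_value)); [|now apply rec_value_least].
           intros b' y' hb'. apply hpb. exact (ord_mem_trans hb' hba ha).
      * split; [exact ha|split].
        -- intros b hb'. destruct (IH b hb') as [y hy].
           exists y. now apply hpb.
        -- apply (least_above_ext (F := rec_value)); [exact hpb|exact hx].
Qed.

Lemma ordinal_recursion : exists f : M,
  is_function f k /\ forall a x, maps f a x -> least_above (maps f) a x.
Proof.
  destruct (@function_exists k rec_value) as [f [hf hmaps]].
  - exact rec_value_definable.
  - intros a x y _. apply rec_value_unique.
  - exact rec_value_total.
  - exists f. split; [exact hf|]. intros a x hx. apply hmaps in hx.
    destruct hx as [ha hx].
    apply (least_above_ext (F := rec_value)); [|now apply rec_value_least].
    intros b y hb. rewrite hmaps. split; [|tauto].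
    intro hy. split; [exact (ord_trans hb ha)|exact hy].
Qed.

End Recursion.

(** The recursion is strictly increasing, so its value at [a] is never below [a]. If it missed some
    [x] in [T], minimality would keep all values below [x], including the value at [x] itself. *)
Lemma unbounded_enumeration (T : M -> Prop) : definable1 U T ->
  (forall a, a ∈ k -> exists x, x ∈ k /\ T x /\ a ∈ x) ->
  exists f : M, is_function f k /\
    (forall a x, maps f a x -> x ∈ k /\ T x) /\
    (forall a a' x, maps f a x -> maps f a' x -> a = a') /\
    (forall x, x ∈ k -> T x -> exists a, maps f a x).
Proof.
  intros hT hun.
  destruct (@ordinal_recursion T (fun y x => y ∈ x)) as [f [hf hleast]].
  - exact hT.
  - definability.
  - exact hun.
  - exact regular_no_max.
  - intros y x x' hx' hyx hxx'. exact (ord_mem_trans hyx hxx' hx').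
  - assert (hval : forall a x, maps f a x -> x ∈ k /\ T x).
    { intros a x hx. destruct (hleast a x hx) as [[h [h' _]] _]. now split. }
    assert (hmono : forall a b x y, b ∈ a -> maps f a x -> maps f b y -> y ∈ x).
    { intros a b x y hb hx hy. destruct (hleast a x hx) as [[_ [_ h]] _].
      exact (h b y hb hy). }
    exists f. split; [exact hf|split; [exact hval|split]].
    + intros a a' x hx hx'.
      destruct (ord_total (function_domain hf hx) (function_domain hf hx'))
        as [h|[h|h]]; [|exact h|];
        destruct (ord_irrefl (proj1 (hval a x hx)));
        eapply hmono; eassumption.
    + assert (hexp : forall a, a ∈ k -> forall x, maps f a x -> ~ x ∈ a).
      { refine (@ordinal_induction _ _ _); [definability|].
        intros a ha IH x hx hxa.
        destruct (function_value hf (ord_trans hxa ha)) as [y hy].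
        apply (IH x hxa y hy). exact (hmono a x x y hxa hx hy). }
      intros x hx hTx. apply NNPP. intro hno.
      assert (hbelow : forall a, a ∈ k -> forall y, maps f a y -> y ∈ x).
      { refine (@ordinal_induction _ _ _); [definability|].
        intros a ha IH y hy.
        destruct (hleast a y hy) as [_ hmin].
        destruct (hmin x) as [->|h]; [|destruct hno; now exists a|exact h].
        split; [exact hx|split; [exact hTx|]].
        intros b z hb hz. exact (IH b hb z hz). }
      destruct (function_value hf hx) as [y hy].
      exact (hexp x hx y hy (hbelow x hx y hy)).
Qed.

Lemma ordinal_mem (a : M) : a ∈ k -> is_ordinal a.
Proof.
  intro ha. split; [|split; [|split; [|split]]].
  - intros x hx y hy. exact (ord_mem_trans hy hx ha).
  - intros x hx. exact (ord_irrefl (ord_trans hx ha)).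
  - intros x y z _ _ hz hxy hyz.
    exact (ord_mem_trans hxy hyz (ord_trans hz ha)).
  - intros x y hx hy. exact (ord_total (ord_trans hx ha) (ord_trans hy ha)).
  - intros s hs hne.
    apply (proj2 (proj2 (proj2 (proj2 (proj1 (proj1 hk)))))); [|exact hne].
    intros x hx. exact (ord_trans (hs x hx) ha).
Qed.

Lemma closure_points_club (E : M -> M -> Prop) : definable2 U E ->
  (forall z, z ∈ k -> exists z', z' ∈ k /\ E z z') ->
  exists C : M, is_club C k /\ forall d, d ∈ C ->
    is_limit d /\ forall z, z ∈ d -> exists z', z' ∈ d /\ E z z'.
Proof.
  intros hE hex.
  destruct (@definable_separation _ _ _ hZ (fun d => is_limit d /\
    forall z, z ∈ d -> exists z', z' ∈ d /\ E z z') k) as [C hC].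
  { unfold is_limit, is_ordinal, is_transitive, well_ordered_by_mem.
    definability. }
  exists C. split; [split; [|split]|].
  - intros d hd. now apply hC in hd.
  - intros a ha.
    (* The choice of [T] puts every value above [a], so the closure point obtained is above [a]
       too. *)
    destruct (@ordinal_recursion (fun x => a ∈ x)
      (fun y x => y ∈ x /\ forall z, z ∈ y -> exists z', z' ∈ x /\ E z z'))
      as [f [hf hleast]].
    { definability. }
    { definability. }
    { intros b hb. destruct (regular_directed ha hb) as [c [hc [hac hbc]]].
      now exists c. }
    { intros y hy.
      destruct (@regular_bounded y E hy hE) as [c [hc h]].
      - intros z hz. exact (hex z (ord_trans hz hy)).
      - destruct (regular_directed hc hy) as [x [hx [hcx hyx]]].
        exists x. split; [exact hx|]. split; [exact hyx|].
        intros z hz. destruct (h z hz) as [z' [hz' hEz]].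
        exists z'. split; [exact (ord_mem_trans hz' hcx hx)|exact hEz]. }
    { intros y x x' hx' [hyx h] hxx'.
      split; [exact (ord_mem_trans hyx hxx' hx')|].
      intros z hz. destruct (h z hz) as [z' [hz' hEz]].
      exists z'. split; [exact (ord_mem_trans hz' hxx' hx')|exact hEz]. }
    (* [f] climbs by closing off under [E], so the supremum [d] of its values
       on [ω] is closed under [E]; it lies below [k] by regularity. *)
    destruct hunc as [_ [w [[[hw1 [[i0 hi0] hw2]] _] hwk]]].
    destruct (@regular_bounded w (fun i x => maps f i x) hwk) as [c [hc hcb]].
    { definability. }
    { intros i hi. destruct (function_value hf (ord_trans hi hwk)) as [x hx].
      exists x. split; [|exact hx]. exact (proj1 (proj1 (hleast i x hx))). }
    destruct (@least_ordinal (fun d => forall i x, i ∈ w -> maps f i x -> x ∈ d))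
      as [d [hd [hdw hmin]]].
    { definability. }
    { exists c. split; [exact hc|]. intros i x hi hx.
      destruct (hcb i hi) as [x' [hx' hm]].
      now rewrite (function_unique hf hx hm). }
    (* [d] is the least strict bound, so [z] is not one: some value [x] is not below [z], and the
       next value [y] exceeds [z]. *)
    assert (hstep : forall z, z ∈ d -> exists i j x y,
      j ∈ w /\ i ∈ j /\ maps f i x /\ maps f j y /\ z ∈ y /\ y ∈ d).
    { intros z hz. apply NNPP. intro hno.
      pose proof (ord_trans hz hd) as hzk.
      enough (hdz : ord_le d z).
      { exact (ord_irrefl hd (ord_le_mem hdz hz hd)). }
      apply (hmin z hzk). intros i x hi hx.
      apply NNPP. intro hxz. apply hno.
      destruct (hw2 i hi) as [j [hj hij]].
      destruct (function_value hf (ord_trans hj hwk)) as [y hy].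
      destruct (hleast j y hy) as [[hyk [_ hyN]] _].
      exists i, j, x, y. repeat split; try assumption.
      - apply (@ord_le_mem z x y); [|exact (proj1 (hyN i x hij hx))|exact hyk].
        apply ord_not_mem; [|exact hzk|exact hxz].
        exact (proj1 (proj1 (hleast i x hx))).
      - exact (hdw j y hj hy). }
    exists d. split.
    { apply hC. split; [exact hd|]. split.
      - split; [exact (ordinal_mem hd)|]. split.
        + destruct (function_value hf (ord_trans hi0 hwk)) as [x hx].
          exists x. exact (hdw i0 x hi0 hx).
        + intros z hz. destruct (hstep z hz) as [i [j [x [y h]]]].
          exists y. tauto.
      - intros z hz. destruct (hstep z hz) as [_ [j [_ [y [hj [_ [_ [hy [hzy _]]]]]]]]].
        destruct (hw2 j hj) as [l [hl hjl]].
        destruct (function_value hf (ord_trans hl hwk)) as [u hu].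
        destruct (hleast l u hu) as [[_ [_ huN]] _].
        destruct (proj2 (huN j y hjl hy) z hzy) as [z' [hz' hEz]].
        exists z'. split; [|exact hEz].
        exact (ord_mem_trans hz' (hdw l u hl hu) hd). }
    { destruct (function_value hf (ord_trans hi0 hwk)) as [x hx].
      destruct (hleast i0 x hx) as [[_ [hax _]] _].
      exact (ord_mem_trans hax (hdw i0 x hi0 hx) hd). }
  - intros d hd hlim hcof. apply hC. split; [exact hd|]. split; [exact hlim|].
    intros z hz. destruct (hcof z hz) as [b [hb [hbd hzb]]].
    apply hC in hb. destruct (proj2 (proj2 hb) z hzb) as [z' [hz' hEz]].
    exists z'. split; [exact (ord_mem_trans hz' hbd hd)|exact hEz].
  - intros d hd. now apply hC in hd.
Qed.

(** * Increasing sequences and filtrations *)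

Section IncreasingSequence.

Context (b : M) (hb : increasing_seq b k).

Lemma increasing_le (c d x y : M) :
  ord_le c d -> d ∈ k -> maps b c x -> maps b d y -> subset x y.
Proof.
  intros [->|h] hd hx hy.
  - rewrite (function_unique (proj1 hb) hx hy). now intro.
  - exact (proj2 hb c d x y hd h hx hy).
Qed.

Lemma eventually_constant_union (a x : M) : a ∈ k -> maps b a x ->
  (forall d y, d ∈ k -> a ∈ d -> maps b d y -> x = y) ->
  contains_club (fun d => is_union_below x b d) k.
Proof.
  intros ha hx hconst.
  destruct (@definable_separation _ _ _ hZ (fun d => a ∈ d) k) as [C hC];
    [definability|].
  exists C. split; [split; [|split]|].
  - intros d hd. now apply hC in hd.
  - intros c hc. destruct (regular_directed ha hc) as [d [hd [had hcd]]].
    exists d. split; [now apply hC|exact hcd].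
  - intros d hd [_ [[c hc] _]] hcof. apply hC. split; [exact hd|].
    destruct (hcof c hc) as [e [he [hed _]]]. apply hC in he.
    exact (ord_mem_trans (proj2 he) hed hd).
  - intros d hd. apply hC in hd. destruct hd as [hd had]. intro z. split.
    + intro hz. now exists a, x.
    + intros [c [y [hc [hy hz]]]]. pose proof (ord_trans hc hd) as hck.
      destruct (ord_total ha hck) as [h|h].
      * now rewrite (hconst c y hck h hy).
      * apply (@increasing_le c a y x); try assumption.
        destruct h as [->|h]; [now left|now right].
Qed.

Context (b_changes : forall a x, a ∈ k -> maps b a x ->
  exists d y, d ∈ k /\ a ∈ d /\ maps b d y /\ x <> y).

(** Each value of [b] is represented by the first index at which it occurs. These indices are
    unbounded in [k], and their enumeration in order type [k] is the desired bijection, read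
    backwards. *)
Lemma increasing_range_card (X : M) :
  (forall y, y ∈ X <-> exists a, a ∈ k /\ maps b a y) -> has_card X k.
Proof.
  intro hX. pose proof (proj1 hb) as hbf.
  set (T := fun a => forall c y, c ∈ a -> maps b a y -> ~ maps b c y).
  assert (hT : definable1 U T) by (unfold T; definability).
  assert (hfirst : forall y, (exists a, a ∈ k /\ maps b a y) ->
    exists a, a ∈ k /\ maps b a y /\ T a).
  { intros y hy. destruct (@least_ordinal (fun a => maps b a y)) as [a [ha [hay hmin]]].
    - definability.
    - exact hy.
    - exists a. split; [exact ha|]. split; [exact hay|].
      intros c y' hc hy' hcy. rewrite (function_unique hbf hy' hay) in hcy.
      pose proof (ord_trans hc ha) as hck.
      exact (ord_irrefl hck (ord_mem_le hc (hmin c hck hcy) hck)). }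
  destruct (@unbounded_enumeration T) as [f [hf [hfT [finj fsurj]]]].
  { exact hT. }
  { intros a ha. destruct (function_value hbf ha) as [x hx].
    destruct (b_changes ha hx) as [d [y [hd [had [hy hne]]]]].
    destruct (hfirst y (ex_intro _ d (conj hd hy))) as [c [hc [hcy hTc]]].
    exists c. split; [exact hc|]. split; [exact hTc|].
    (* If [y] had first occurred at some [c ≤ a], then [y ⊆ x ⊆ y] by monotonicity, so [b] would not
       have changed. *)
    apply NNPP. intro hac. apply hne. apply (zfc_extensionality hZ).
    intro z. split.
    - apply (increasing_le (or_intror had) hd hx hy).
    - apply (@increasing_le c a y x); [|exact ha|exact hcy|exact hx].
      exact (ord_not_mem ha hc hac). }
  split; [exact (proj1 hk)|].
  destruct (@function_exists X (fun y a => exists s, maps f a s /\ maps b s y))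
    as [g [hg hmaps]].
  { definability. }
  { intros y a a' _ [s [hs hy]] [s' [hs' hy']].
    destruct (hfT a s hs) as [hsk hTs], (hfT a' s' hs') as [hsk' hTs'].
    destruct (ord_total hsk hsk') as [h|[h|h]].
    - destruct (hTs' s y h hy' hy).
    - subst s'. exact (finj a a' s hs hs').
    - destruct (hTs s' y h hy hy'). }
  { intros y hy. apply hX in hy.
    destruct (hfirst y hy) as [s [hs [hsy hTs]]].
    destruct (fsurj s hs hTs) as [a ha]. now exists a, s. }
  exists g. split; [split; [exact hg|]|split].
  - intros y a h. apply hmaps in h. destruct h as [_ [s [hs _]]].
    exact (function_domain hf hs).
  - intros y y' a h h'. apply hmaps in h, h'.
    destruct h as [_ [s [hs hy]]], h' as [_ [s' [hs' hy']]].
    rewrite (function_unique hf hs hs') in hy.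
    exact (function_unique hbf hy hy').
  - intros a ha. destruct (function_value hf ha) as [s hs].
    destruct (hfT a s hs) as [hsk _].
    destruct (function_value hbf hsk) as [y hy].
    exists y. apply hmaps. split; [apply hX; now exists s|now exists s].
Qed.

End IncreasingSequence.

(** Fewer than [k] indices lie below [n], so by regularity the members of [c] occurring there have
    [g]-positions bounded by some [m]. The member at position [m] therefore occurs only from [n] on,
    beyond [z]. *)
Lemma full_card_cofinal (b c : M) :
  is_function b k -> (forall y, y ∈ c -> exists a, a ∈ k /\ maps b a y) ->
  has_card c k -> forall z, z ∈ k ->
  exists d y, d ∈ k /\ z ∈ d /\ maps b d y /\ y ∈ c.
Proof.
  intros hb hc [_ [g [[hg hgk] [ginj gsurj]]]] z hz.
  apply NNPP. intro hno.
  destruct (regular_no_max hz) as [n [hn hzn]].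
  destruct (@regular_bounded n
    (fun i a => forall y, maps b i y -> y ∈ c -> maps g y a)) as [m [hm h]].
  - exact hn.
  - definability.
  - intros i hi. destruct (function_value hb (ord_trans hi hn)) as [y hy].
    destruct (classic (y ∈ c)) as [hyc|hyc].
    + destruct (function_value hg hyc) as [a ha].
      exists a. split; [exact (hgk y a ha)|].
      intros y' hy' _. now rewrite (function_unique hb hy' hy).
    + exists z. split; [exact hz|]. intros y' hy' hyc'.
      destruct hyc. now rewrite (function_unique hb hy hy').
  - destruct (gsurj m hm) as [y hy].
    pose proof (function_domain hg hy) as hyc.
    destruct (hc y hyc) as [d [hd hdy]].
    destruct (classic (d ∈ n)) as [hdn|hdn].
    + destruct (h d hdn) as [a [ha hga]].
      rewrite (function_unique hg (hga y hdy hyc) hy) in ha.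
      exact (ord_irrefl hm ha).
    + apply hno. exists d, y. repeat split; try assumption.
      exact (ord_mem_le hzn (ord_not_mem hd hn hdn) hd).
Qed.

(** For [d] in the club, every [w ∈ s(d)] contained in some value of [b] is
    contained in some [b(c)] with [c ∈ d], so restricting to the [w ⊆ b(d)]
    lets in nothing beyond the union below [d]. *)
Lemma filtration_union_club (b A s C : M) :
  increasing_seq b k -> is_filtration s A k -> is_club C k ->
  (forall z, z ∈ k -> exists d y, d ∈ k /\ z ∈ d /\ maps b d y /\ y ∈ A) ->
  contains_club (fun d => d ∈ C /\ forall x y u, maps s d x -> maps b d y ->
    (forall z, z ∈ u <-> exists w, w ∈ x /\ subset w y /\ z ∈ w) ->
    is_union_below u b d) k.
Proof.
  intros hb [hs [hsmall [hcont hunion]]] [hCk [hCunb hClim]] hcof.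
  pose proof (proj1 hb) as hbf. pose proof (proj1 hs) as hsf.
  (* The first clause makes closure points limits of [C]. The second puts cofinally many values of
     [b] that belong to [A] into earlier stages of [s]. The third provides earlier values of [b] as
     covers. *)
  destruct (@closure_points_club (fun z z' =>
    (exists c, c ∈ C /\ z ∈ c /\ c ∈ z') /\
    (exists d a y x, d ∈ z' /\ a ∈ z' /\ z ∈ d /\ maps b d y /\ maps s a x /\
       y ∈ x) /\
    (forall x y, maps s z x -> y ∈ x ->
       (exists a v, a ∈ k /\ maps b a v /\ subset y v) ->
       exists a v, a ∈ z' /\ maps b a v /\ subset y v))) as [D [hD hDd]].
  { definability. }
  { intros z hz.
    destruct (hCunb z hz) as [c [hc hzc]].
    destruct (hcof z hz) as [d [y [hd [hzd [hy hyA]]]]].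
    destruct (proj1 (hunion y) hyA) as [a [x [ha [hx hyx]]]].
    destruct (function_value hsf hz) as [x' hx'].
    (* The stage [x'] has size below [k], so one bound serves all its members; those covered by no
       value of [b] satisfy the implication vacuously. *)
    destruct (@card_lt_bounded x' (fun y a =>
      (exists a v, a ∈ k /\ maps b a v /\ subset y v) ->
      exists v, maps b a v /\ subset y v)) as [m [hm hmb]].
    { exact (hsmall z x' hz hx'). }
    { definability. }
    { intros w _.
      destruct (classic (exists a v, a ∈ k /\ maps b a v /\ subset w v))
        as [[e [v [he hv]]]|hno].
      - exists e. split; [exact he|]. intros _. now exists v.
      - exists z. split; [exact hz|]. intro h. now destruct hno. }
    destruct (regular_directed (hCk c hc) hd) as [e [he [hce hde]]].
    destruct (regular_directed ha hm) as [e' [he' [hae' hme']]].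
    destruct (regular_directed he he') as [z' [hz' [hez' hez'']]].
    exists z'. split; [exact hz'|]. split; [|split].
    - exists c. repeat split; try assumption.
      exact (ord_mem_trans hce hez' hz').
    - exists d, a, y, x. repeat split; try assumption.
      + exact (ord_mem_trans hde hez' hz').
      + exact (ord_mem_trans hae' hez'' hz').
    - intros x'' w hx'' hw hex. rewrite (function_unique hsf hx'' hx') in hw.
      destruct (hmb w hw) as [a' [ha' h]]. destruct (h hex) as [v hv].
      exists a', v. split; [|exact hv].
      exact (ord_mem_trans ha' (ord_mem_trans hme' hez'' hz') hz'). }
  exists D. split; [exact hD|].
  intros d hd. destruct (hDd d hd) as [hlim hclosed].
  pose proof (proj1 hD d hd) as hdk.
  split.
  - apply (hClim d hdk hlim). intros z hz.
    destruct (hclosed z hz) as [z' [hz' [[c [hc [hzc hcz']]] _]]].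
    exists c. repeat split; try assumption.
    exact (ord_mem_trans hcz' hz' hdk).
  - intros x y u hx hy hu z. rewrite hu. split.
    + intros [w [hw [hwy hz]]].
      destruct (proj1 (hcont d x hdk hlim hx w) hw) as [a [x' [ha [hx' hwx']]]].
      destruct (hclosed a ha) as [z' [hz' [_ [_ h]]]].
      destruct (h x' w hx' hwx') as [a' [v [ha' [hv hwv]]]].
      { now exists d, y. }
      exists a', v. split; [exact (ord_mem_trans ha' hz' hdk)|].
      split; [exact hv|exact (hwv z hz)].
    (* [b(a)] is enlarged to a later value [w = b(e)] that already lies in a stage before [d]; as
       [e ∈ d], also [w ⊆ b(d)]. *)
    + intros [a [v [ha [hv hz]]]].
      destruct (hclosed a ha) as
        [z' [hz' [_ [[e [e' [w [x' [he [he' [hae [hw [hx' hwx']]]]]]]]] _]]]].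
      exists w. split; [|split].
      * apply (hcont d x hdk hlim hx). exists e', x'. split; [|now split].
        exact (ord_mem_trans he' hz' hdk).
      * apply (proj2 hb e d w y hdk); try assumption.
        exact (ord_mem_trans he hz' hdk).
      * apply (proj2 hb a e v w); try assumption.
        exact (ord_trans he (ord_trans hz' hdk)).
Qed.

End Regular.

End SetTheory.

(** * The inner model and the conclusion *)

(** Separation and union are carried out in [W]. Transitivity of [W] makes inclusion and union mean
    the same there as in [V]. *)
Lemma inner_union (V : set_structure) (W : V -> Prop) (hW : inner_model W)
    (x y : V) : W x -> W y ->
  exists u, W u /\
    forall z, z ∈ u <-> exists w, w ∈ x /\ subset w y /\ z ∈ w.
Proof.
  intros hx hy. pose proof (inner_transitive hW) as htr.
  set (x' := exist W x hx : submodel W). set (y' := exist W y hy : submodel W).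
  (* Under the quantifier, 0 is the bound element, 1 the candidate [w] and 2 the parameter [y']; the
     formula says [w ⊆ y]. *)
  destruct (zfc_separation (inner_ZFC hW)
    (FAll (FImp (FMem _ 0 1) (FMem _ 0 2))) (fun _ => y') x') as [B hB].
  destruct (zfc_union (inner_ZFC hW) B) as [[u hu] hunion].
  exists u. split; [exact hu|]. intro z. split.
  - intro hz.
    destruct (proj1 (hunion (exist W z (htr z u hu hz))) hz) as [w [hw hzw]].
    apply hB in hw. destruct hw as [hwx hwy].
    exists (proj1_sig w). split; [exact hwx|]. split; [|exact hzw].
    intros v hv.
    exact (hwy (exist W v (htr v (proj1_sig w) (proj2_sig w) hv)) hv).
  - intros [w [hwx [hwy hzw]]].
    pose proof (htr w x hx hwx) as hw. pose proof (htr z w hw hzw) as hz.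
    apply (proj2 (hunion (exist W z hz))). exists (exist W w hw).
    split; [|exact hzw]. apply hB. split; [exact hwx|].
    intros v hv. exact (hwy (proj1_sig v) hv).
Qed.

Theorem theorem3p3
  (V : set_structure) (W : V -> Prop) (hW : inner_model W)
  (kappa : V) (hreg : is_regular kappa) (hunc : is_uncountable_cardinal kappa)
  (lambda : submodel W) (hlambda : is_cardinal lambda)
  (hlt : kappa ∈ proj1_sig lambda)
  (P : submodel W)
  (hP : subset_small_powerset P lambda
          (ordinal_in_inner hW (regular_ordinal hreg)))
  (hPcard : has_card P lambda) :
  F_property W (proj1_sig P) kappa -> G_property W (proj1_sig P) kappa.
Proof.
  intros hF b hb hbP. pose proof (inner_ZFC_univ hW) as hZ.
  assert (hbW : forall a x, a ∈ kappa -> maps b a x -> W x).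
  { intros a x ha hx.
    exact (inner_transitive hW (proj2_sig P) (hbP a x ha hx)). }
  destruct (classic (forall a x, a ∈ kappa -> maps b a x ->
    exists d y, d ∈ kappa /\ a ∈ d /\ maps b d y /\ x <> y)) as [hchange|hconst].
  - destruct (@definable_replacement _ _ _ hZ (maps b) kappa) as [X hX].
    { definability. }
    { intros a x y _. apply (function_unique hZ (proj1 hb)). }
    (* [X] is the range of [b]. Since [c = X ∩ A] has full size, values of [b] lying in [A] occur at
       cofinally many indices. *)
    destruct (hF X) as [A [_ [_ [[_ [_ [s [hs [C [hC hCW]]]]]] [c [hc hcard]]]]]].
    { intros y hy. apply hX in hy. destruct hy as [a [ha hy]].
      exact (hbP a y ha hy). }
    { exact (increasing_range_card hZ hreg hunc hb hchange hX). }
    destruct (@filtration_union_club _ _ _ hZ kappa hreg hunc b A s C hb hs hC)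
      as [D [hD hDu]].
    { intros z hz.
      destruct (@full_card_cofinal _ _ _ hZ kappa hreg hunc b c (proj1 hb))
        with (z := z) as [d [y [hd [hzd [hy hyc]]]]].
      - intros y hy. apply hX. now apply hc.
      - exact hcard.
      - exact hz.
      - exists d, y. repeat split; try assumption. now apply hc. }
    exists D. split; [exact hD|]. intros d hd.
    destruct (hDu d hd) as [hdC hu].
    destruct (hCW d hdC) as [x [hx hxW]].
    pose proof (proj1 hD d hd) as hdk.
    destruct (function_value (proj1 hb) hdk) as [y hy].
    (* Both inputs lie in [W]: [s(d)] because [d ∈ C], and [b(d)] as an element of [P]. *)
    destruct (inner_union hW hxW (hbW d y hdk hy)) as [u [huW huz]].
    exists u. split; [exact (hu x y u hx hy huz)|exact huW].
  - apply NNPP. intro hno. apply hconst. intros a x ha hx.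
    apply NNPP. intro hsame. apply hno.
    destruct (eventually_constant_union hZ hreg hunc hb ha hx) as [C [hC hCu]].
    { intros d y hd had hy. apply NNPP. intro hne. apply hsame.
      now exists d, y. }
    exists C. split; [exact hC|]. intros d hd.
    exists x. split; [exact (hCu d hd)|exact (hbW a x ha hx)].
Qed.
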